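(* For a Coxeter graph $\Gamma$ let $A_\Gamma$ denote the Artin group of type $\Gamma$ and $A_\Gamma'$ its commutator subgroup. The following commutator subgroups are finitely generated and perfect: (1) $A_{A_n}'$ for $n\ge 4$; (2) $A_{B_n}'$ for $n\ge 5$; (3) $A_{D_n}'$ for $n\ge 5$; (4) $A_{E_n}'$ for $n=6,7,8$; (5) $A_{H_n}'$ for $n=3,4$. Hence the corresponding Artin groups $A_{A_n}$ ($n\ge4$), $A_{B_n}$ ($n\ge5$), $A_{D_n}$ ($n\ge5$), $A_{E_n}$ ($n=6,7,8$) and $A_{H_n}$ ($n=3,4$) are not locally indicable.
   Context: A Coxeter graph $\Gamma$ with vertices $1,\dots,n$ encodes numbers $m_{ij}\in\{2,3,\dots,\infty\}$ ($i\ne j$): $m_{ij}=2$ if $i,j$ are not joined, $m_{ij}=3$ if joined by an unlabelled edge, and $m_{ij}$ is the label otherwise. The Artin group $A_\Gamma$ has generators $a_1,\dots,a_n$ and relations $\langle a_ia_j\rangle^{m_{ij}}=\langle a_ja_i\rangle^{m_{ij}}$ whenever $i\neq j$ and $m_{ij}<\infty$, where $\langle ab\rangle^q=aba\cdots$ ($q$ factors). Types: $A_n$ ($n\ge1$): path $1-2-\cdots-n$, all edges unlabelled. $B_n$ ($n\ge2$): path $1-\cdots-n$ with the edge $\{n-1,n\}$ labelled $4$, other edges unlabelled. $D_n$ ($n\ge4$): path $1-\cdots-(n-2)$ together with edges $\{n-2,n-1\}$ and $\{n-2,n\}$, all unlabelled. $E_n$ ($n=6,7,8$): path $1-\cdots-(n-1)$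 together with the edge $\{3,n\}$, all unlabelled. $H_n$ ($n=3,4$): path $1-\cdots-n$ with the edge $\{1,2\}$ labelled $5$, other edges unlabelled. A group is perfect if it equals its own commutator subgroup. A group $G$ is locally indicable if every nontrivial finitely generated subgroup $H$ of $G$ admits a nontrivial homomorphism $H\to\mathbb{Z}$. *)

(* Defs.v *)
From HB Require Import structures.
From mathcomp Require Import all_boot all_order all_algebra.
From mathcomp Require Import boolp classical_sets functions cardinality.

Set Implicit Arguments.
Unset Strict Implicit.
Unset Printing Implicit Defensive.

Local Open Scope classical_set_scope.
Local Open Scope quotient_scope.

(* The letter (x, false) stands for the generator x and (x, true) for its
   inverse. *)
Definition word (X : choiceType) := seq (X * bool).

Definition word_inv (X : choiceType) (w : word X) : word X :=
  rev [seq (l.1, ~~ l.2) | l <- w].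

Inductive word_eq (X : choiceType) (R : word X -> word X -> Prop) :
    word X -> word X -> Prop :=
| word_eq_refl w : word_eq R w w
| word_eq_sym u v : word_eq R u v -> word_eq R v u
| word_eq_trans u v w : word_eq R u v -> word_eq R v w -> word_eq R u w
| word_eq_cat u u' v v' :
    word_eq R u u' -> word_eq R v v' -> word_eq R (u ++ v) (u' ++ v')
| word_eq_cancel x b : word_eq R [:: (x, b); (x, ~~ b)] [::]
| word_eq_rel u v : R u v -> word_eq R u v.

Section PresentedGroup.
Variables (X : choiceType) (R : word X -> word X -> Prop).
Implicit Types u v w : word X.

Definition word_eqb : rel (word X) := fun u v => `[< word_eq R u v >].

Lemma word_eqb_refl : reflexive word_eqb.
Proof. by move=> w; apply/asboolP; exact: word_eq_refl. Qed.

Lemma word_eqb_sym : symmetric word_eqb.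
Proof. by move=> u v; apply/asboolP/asboolP; exact: word_eq_sym. Qed.

Lemma word_eqb_trans : transitive word_eqb.
Proof.
by move=> v u w /asboolP uv /asboolP vw; apply/asboolP; exact: word_eq_trans uv vw.
Qed.

Canonical word_equiv : equiv_rel (word X) :=
  EquivRel word_eqb word_eqb_refl word_eqb_sym word_eqb_trans.

Lemma word_invV w : word_eq R (w ++ word_inv w) [::].
Proof.
elim: w => [|[x b] w IHw]; first exact: word_eq_refl.
have -> : ((x, b) :: w) ++ word_inv ((x, b) :: w) =
          [:: (x, b)] ++ ((w ++ word_inv w) ++ [:: (x, ~~ b)]).
  by rewrite /word_inv /= rev_cons -cats1 catA.
apply: word_eq_trans (word_eq_cancel R x b).
apply: (word_eq_cat (word_eq_refl R [:: (x, b)])).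
exact: (word_eq_cat IHw (word_eq_refl R [:: (x, ~~ b)])).
Qed.

Lemma word_invK : involutive (@word_inv X).
Proof.
move=> w; rewrite /word_inv map_rev revK -map_comp -[RHS]map_id.
by apply: eq_map => -[x b] /=; rewrite negbK.
Qed.

Lemma word_Vinv w : word_eq R (word_inv w ++ w) [::].
Proof. by rewrite -{2}(word_invK w); exact: word_invV. Qed.

Lemma word_inv_eq u v : word_eq R u v -> word_eq R (word_inv u) (word_inv v).
Proof.
move=> uv.
apply: (@word_eq_trans _ _ _ (word_inv u ++ (v ++ word_inv v))).
  rewrite -{1}[word_inv u]cats0.
  by apply: word_eq_cat (word_eq_refl _ _) (word_eq_sym (word_invV v)).
rewrite catA -[X in word_eq _ _ X]cat0s.
apply: word_eq_cat (word_eq_refl _ _).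
apply: word_eq_trans (word_Vinv u).
by apply: word_eq_cat (word_eq_refl _ _) (word_eq_sym uv).
Qed.

(* The group < X | u = v for all u, v with R u v >. *)
Definition presented := {eq_quot word_equiv}.

HB.instance Definition _ := Choice.on presented.
HB.instance Definition _ := EqQuotient.on presented.

Lemma presented_eqP u v :
  (\pi_presented u = \pi_presented v) <-> word_eq R u v.
Proof. by split=> [/eqmodP /asboolP | uv]; last by apply/eqmodP/asboolP. Qed.

Definition presented_one : presented := \pi_presented [::].
Definition presented_mul (x y : presented) : presented :=
  \pi_presented (repr x ++ repr y).
Definition presented_inv (x : presented) : presented :=
  \pi_presented (word_inv (repr x)).

Lemma repr_word_eq u : word_eq R (repr (\pi_presented u)) u.
Proof. by apply/presented_eqP; rewrite reprK. Qed.

Lemma presented_mul_pi u v :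
  presented_mul (\pi_presented u) (\pi_presented v) = \pi_presented (u ++ v).
Proof. by apply/presented_eqP; apply: word_eq_cat; exact: repr_word_eq. Qed.

Lemma presented_inv_pi u :
  presented_inv (\pi_presented u) = \pi_presented (word_inv u).
Proof. by apply/presented_eqP; apply: word_inv_eq; exact: repr_word_eq. Qed.

Lemma presented_mulA : associative presented_mul.
Proof.
elim/quotW=> u; elim/quotW=> v; elim/quotW=> w.
by rewrite (presented_mul_pi v w) (presented_mul_pi u v) !presented_mul_pi catA.
Qed.

Lemma presented_1mul : left_id presented_one presented_mul.
Proof. by elim/quotW=> u; rewrite [LHS]presented_mul_pi. Qed.

Lemma presented_mul1 : right_id presented_one presented_mul.
Proof. by elim/quotW=> u; rewrite [LHS]presented_mul_pi cats0. Qed.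

Lemma presented_mulV : left_inverse presented_one presented_inv presented_mul.
Proof.
elim/quotW=> u; rewrite (presented_inv_pi u) presented_mul_pi.
by apply/presented_eqP; exact: word_Vinv.
Qed.

Lemma presented_Vmul : right_inverse presented_one presented_inv presented_mul.
Proof.
elim/quotW=> u; rewrite (presented_inv_pi u) presented_mul_pi.
by apply/presented_eqP; exact: word_invV.
Qed.

HB.instance Definition _ := isGroup.Build presented presented_mulA
  presented_1mul presented_mul1 presented_mulV presented_Vmul.

End PresentedGroup.

(* [None] encodes the label oo; the values [cox_label i i] are irrelevant. *)
Record coxeter_graph (n : nat) := CoxeterGraph {
  cox_label : 'I_n -> 'I_n -> option nat;
  cox_label_sym : forall i j, cox_label i j = cox_label j i;
  cox_label_ge2 : forall i j m, i != j -> cox_label i j = Some m -> 2 <= m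
}.

Fixpoint alt_word (X : choiceType) (q : nat) (a b : X) : word X :=
  if q is q'.+1 then (a, false) :: alt_word q' b a else [::].

Inductive artin_rel n (Gamma : coxeter_graph n) :
    word 'I_n -> word 'I_n -> Prop :=
| ArtinRel i j m : i != j -> cox_label Gamma i j = Some m ->
    artin_rel Gamma (alt_word m i j) (alt_word m j i).

Definition artin_group n (Gamma : coxeter_graph n) : groupType :=
  presented (artin_rel Gamma).

(* The graph on vertices 1, ..., n, vertex p being the ordinal of value p - 1,
   in which p < q are given the label [l p q]. *)
Section FiniteLabels.
Variables (n : nat) (l : nat -> nat -> nat) (l_ge2 : forall p q, 2 <= l p q).

Definition mk_label (i j : 'I_n) : option nat :=
  Some (l (minn i j).+1 (maxn i j).+1).

Lemma mk_label_sym i j : mk_label i j = mk_label j i.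
Proof. by rewrite /mk_label minnC maxnC. Qed.

Lemma mk_label_ge2 i j m : i != j -> mk_label i j = Some m -> 2 <= m.
Proof. by move=> _ [<-]. Qed.

Definition mk_coxeter_graph : coxeter_graph n :=
  CoxeterGraph mk_label_sym mk_label_ge2.

End FiniteLabels.

Definition labelA (p q : nat) : nat := if q == p.+1 then 3 else 2.
Definition labelB (n p q : nat) : nat :=
  if q == p.+1 then (if q == n then 4 else 3) else 2.
Definition labelD (n p q : nat) : nat :=
  if (q == p.+1) && (q < n) || (p.+2 == n) && (q == n) then 3 else 2.
Definition labelE (n p q : nat) : nat :=
  if (q == p.+1) && (q < n) || (p == 3) && (q == n) then 3 else 2.
Definition labelH (p q : nat) : nat :=
  if q == p.+1 then (if p == 1 then 5 else 3) else 2.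

Lemma labelA_ge2 p q : 2 <= labelA p q.
Proof. by rewrite /labelA; case: ifP. Qed.
Lemma labelB_ge2 n p q : 2 <= labelB n p q.
Proof. by rewrite /labelB; do 2?case: ifP. Qed.
Lemma labelD_ge2 n p q : 2 <= labelD n p q.
Proof. by rewrite /labelD; case: ifP. Qed.
Lemma labelE_ge2 n p q : 2 <= labelE n p q.
Proof. by rewrite /labelE; case: ifP. Qed.
Lemma labelH_ge2 p q : 2 <= labelH p q.
Proof. by rewrite /labelH; do 2?case: ifP. Qed.

Definition typeA (n : nat) := mk_coxeter_graph n labelA_ge2.
Definition typeB (n : nat) := mk_coxeter_graph n (labelB_ge2 n).
Definition typeD (n : nat) := mk_coxeter_graph n (labelD_ge2 n).
Definition typeE (n : nat) := mk_coxeter_graph n (labelE_ge2 n).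
Definition typeH (n : nat) := mk_coxeter_graph n labelH_ge2.

Section Subgroups.
Local Open Scope group_scope.
Variable G : groupType.
Implicit Types (S H : set G).

Definition subgroup H : Prop :=
  H 1 /\ (forall x y, H x -> H y -> H (x * y^-1)).

Definition generated S : set G := smallest subgroup S.

Definition derived H : set G := generated [set [~ x, y] | x in H & y in H].

Definition finitely_generated H : Prop :=
  exists2 S, finite_set S & H = generated S.

Definition perfect H : Prop := derived H = H.

(* Homomorphisms H -> Z are represented by functions on G, whose values
   outside H are irrelevant. *)
Definition locally_indicable : Prop :=
  forall H, subgroup H -> finitely_generated H -> H <> [set 1] ->
  exists f : G -> int,
    (forall x y, H x -> H y -> f (x * y) = (f x + f y)%R) /\
    (exists2 x, H x & f x <> 0%R).

End Subgroups.

Definition commutator_subgroup (G : groupType) : set G := derived [set: G].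

Arguments locally_indicable : clear implicits.
Arguments commutator_subgroup : clear implicits.

(* Main.v *)
Require Import Defs.
From mathcomp Require Import all_boot all_order all_algebra.
From mathcomp Require Import boolp classical_sets cardinality.
From mathcomp Require Import zify ring.

(* Let G be one of these Artin groups and Q = G / G''. An element x of Q' commutes
   with Q', so it is central as soon as it commutes with one generator a_k (and,
   in type B, with a_n), because all generators a_p (p < n in type B) are
   congruent modulo Q'. For x = a_2 / a_1 and a_k not joined to vertices 1, 2 this
   makes a_1 and a_2 commute, hence equal by their odd Artin relation; going down
   the tree, all a_p are equal, Q is abelian and G' = G''. In type H_3 the
   central element a_1 / a_3 plays this role.
   G' is generated by the conjugates of the a_p / a_r under the powers of a_r and,
   in type B, of a_n; the Artin relations express each of them through finitely
   many. It is nontrivial, as a reflection representation over F_5 shows, so,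
   being perfect, it contradicts local indicability. *)

Set Implicit Arguments.
Unset Strict Implicit.
Unset Printing Implicit Defensive.

Import GRing.Theory.

(** * Subgroups, derived subgroups and local indicability *)

Section SubgroupTheory.
Local Open Scope classical_set_scope.
Local Open Scope group_scope.
Variable G : groupType.
Implicit Types (S H : set G) (x y g h : G).

Lemma subgroup1 H : subgroup H -> H 1.
Proof. by case. Qed.

Lemma subgroupV H x : subgroup H -> H x -> H x^-1.
Proof. by case=> H1 HF Hx; rewrite -[x^-1]mul1g; exact: HF. Qed.

Lemma subgroupM H x y : subgroup H -> H x -> H y -> H (x * y).
Proof.
move=> sH Hx Hy; rewrite -[y]invgK; case: (sH) => _; apply=> //.
exact: subgroupV.
Qed.

Lemma subgroup_generated S : subgroup (generated S).
Proof.
split=> [A [[A1 _] _] //|x y Sx Sy A [sA SA]].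
by case: (sA) => _; apply; [exact: Sx | exact: Sy].
Qed.

Lemma generated_sub S H : subgroup H -> S `<=` H -> generated S `<=` H.
Proof. exact: smallest_sub. Qed.

Lemma subgroup_conjg H g : subgroup H -> subgroup [set x | H (x ^ g)].
Proof.
move=> [H1 HF]; split=> /= [|x y]; first by rewrite conj1g.
by rewrite conjMg conjVg; exact: HF.
Qed.

(** Stability under both [g] and [g^-1] is required because an infinite [S] may be mapped properly
    into itself by [g]. *)
Lemma subgroup_normaliser S :
  subgroup [set g | forall h, S h -> S (h ^ g) /\ S (h ^ g^-1)].
Proof.
split=> /= [h Sh|x y Nx Ny h Sh]; first by rewrite invg1 !conjg1.
rewrite invgF !conjgM.
by split; [case: (Nx h Sh) => /Ny[] | case: (Ny h Sh) => /Nx[]].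
Qed.

Lemma subgroup_centraliser S : subgroup [set g | forall h, S h -> commute h g].
Proof.
split=> /= [h _|x y Cx Cy h Sh]; first exact: commute1.
by apply: commuteM; [exact: Cx | apply: commuteV; exact: Cy].
Qed.

Lemma generated_conjg S g : (forall h, S h -> generated S (h ^ g)) ->
  forall h, generated S h -> generated S (h ^ g).
Proof.
by move=> Sg; apply: generated_sub => //; exact/subgroup_conjg/subgroup_generated.
Qed.

Lemma subgroup_derived H : subgroup (derived H).
Proof. exact: subgroup_generated. Qed.

Lemma derivedR H x y : H x -> H y -> derived H [~ x, y].
Proof. by move=> Hx Hy; apply: sub_gen_smallest; exists x => //; exists y. Qed.

Lemma derived_conjg H g : (forall h, H h -> H (h ^ g)) ->
  forall h, derived H h -> derived H (h ^ g).
Proof.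
move=> Hg; apply: generated_conjg => _ [x Hx [y Hy <-]].
by rewrite conjRg; apply: derivedR; exact: Hg.
Qed.

Lemma derived_subgroup_sub H : subgroup H -> derived H `<=` H.
Proof.
move=> sH; apply: generated_sub => // _ [x Hx [y Hy <-]].
rewrite /commg /conjg.
by do !apply: subgroupM => //; apply: subgroupV.
Qed.

Lemma commutator_subgroupR x y : commutator_subgroup G [~ x, y].
Proof. exact: derivedR. Qed.

Lemma subgroup_commutator_subgroup : subgroup (commutator_subgroup G).
Proof. exact: subgroup_derived. Qed.

Lemma commutator_subgroup_conjg g x :
  commutator_subgroup G x -> commutator_subgroup G (x ^ g).
Proof. exact: derived_conjg. Qed.

(** A homomorphism to the abelian group Z kills every commutator, hence all of a perfect [H]. *)
Lemma not_locally_indicable_perfect H :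
    subgroup H -> finitely_generated H -> perfect H -> H <> [set 1] ->
  ~ locally_indicable G.
Proof.
move=> sH fH pH H1 /(_ H sH fH H1)[f [fM [x Hx]]]; apply.
have f1 : f 1 = 0%R.
  apply: (addrI (f 1)); rewrite addr0 -fM ?mulg1 //; exact: subgroup1.
have fV y : H y -> f y^-1 = (- f y)%R.
  move=> Hy; apply: (addrI (f y)); rewrite addrN -fM ?mulgV //.
  exact: subgroupV.
(* [f] is additive on [H] only, so its kernel is taken inside [H]. *)
suff sK : subgroup [set y | H y /\ f y = 0%R].
  suff: [set y | H y /\ f y = 0%R] x by case.
  move: Hx; rewrite -{1}pH; move: x; apply: generated_sub => //.
  move=> _ [y Hy [z Hz <-]]; split.
    by apply: (derived_subgroup_sub sH); exact: derivedR.
  have [Hy' Hz'] := (subgroupV sH Hy, subgroupV sH Hz).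
  have Hyz := subgroupM sH Hy Hz.
  rewrite /commg /conjg !fM ?fV //; first by lia.
  exact: subgroupM.
split=> /= [|y z [Hy fy] [Hz fz]]; first by split=> //; exact: subgroup1.
have Hz' := subgroupV sH Hz.
by split; [exact: subgroupM | rewrite fM // fV // fy fz subr0].
Qed.

End SubgroupTheory.

#[local] Hint Resolve subgroup_commutator_subgroup : core.

(* The group G / N, N a normal subgroup of G = < X | R >, is < X | R_N >, where
   R_N relates the words that are equal modulo N. *)
Section Quotient.
Local Open Scope classical_set_scope.
Local Open Scope group_scope.
Local Open Scope quotient_scope.
Variables (X : choiceType) (R : word X -> word X -> Prop).
Local Notation G := (presented R).
Implicit Types u v : word X.

Lemma pi_cat (S : word X -> word X -> Prop) u v :
  \pi_(presented S) (u ++ v) = \pi_(presented S) u * \pi_(presented S) v.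
Proof. by rewrite -presented_mul_pi. Qed.

Lemma pi_word_inv (S : word X -> word X -> Prop) u :
  \pi_(presented S) (word_inv u) = (\pi_(presented S) u)^-1.
Proof. by rewrite -presented_inv_pi. Qed.

Lemma pi_nil (S : word X -> word X -> Prop) : \pi_(presented S) [::] = 1.
Proof. by []. Qed.

Definition quotient_rel (N : set G) u v : Prop := N (\pi_G u / \pi_G v).

(** Each rule of [word_eq] preserves [quotient_rel N]; concatenation is the rule that uses normality
    of [N]. *)
Lemma word_eq_quotient_rel (N : set G) u v :
    subgroup N -> (forall g x, N x -> N (x ^ g)) ->
  word_eq (quotient_rel N) u v -> quotient_rel N u v.
Proof.
move=> sN nN; rewrite /quotient_rel.
elim=> {u v} [w|u v _|u v w _ uv _ vw|u u' v v' _ uu' _ vv'|x b|//].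
- by rewrite mulgV; exact: subgroup1.
- by move/(subgroupV sN); rewrite invgF.
- have -> : \pi_G u / \pi_G w = \pi_G u / \pi_G v * (\pi_G v / \pi_G w).
    by rewrite mulgA mulgVK.
  exact: subgroupM.
- rewrite !pi_cat.
  have -> : \pi_G u * \pi_G v / (\pi_G u' * \pi_G v') =
      (\pi_G v / \pi_G v') ^ (\pi_G u)^-1 * (\pi_G u / \pi_G u').
    by rewrite /conjg invgK invgM !mulgA mulgVK.
  by apply: subgroupM => //; exact: nN.
- suff -> : \pi_G [:: (x, b); (x, ~~ b)] = \pi_G [::].
    by rewrite mulgV; exact: subgroup1.
  by apply/presented_eqP; exact: word_eq_cancel.
Qed.

(** The premise is applied to the presentation of G / G'', whose commutator subgroup is abelian;
    commutativity of this quotient puts every commutator of [G] into G''. *)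
Lemma perfect_commutator_subgroup :
    (forall S : word X -> word X -> Prop,
       (forall u v, R u v -> word_eq S u v) ->
       (forall x y : presented S, commutator_subgroup (presented S) x ->
          commutator_subgroup (presented S) y -> commute x y) ->
     forall x y : presented S, commute x y) ->
  perfect (commutator_subgroup G).
Proof.
move=> meta; set N := derived (commutator_subgroup G).
have sN : subgroup N := subgroup_derived _.
have nN g x : N x -> N (x ^ g).
  by apply: derived_conjg => h; exact: commutator_subgroup_conjg.
apply/seteqP; split; first exact: derived_subgroup_sub.
apply: generated_sub => // _ [x _ [y _ <-]].
pose Q : groupType := presented (quotient_rel N).
(* Every element of Q' is represented by a word whose class in [G] lies in G'. *)
have lift q : commutator_subgroup Q q ->
    exists2 u, commutator_subgroup G (\pi_G u) & \pi_(presented (quotient_rel N)) u = q.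
  move: q; apply: generated_sub.
    split=> [|_ _ [u Du <-] [v Dv <-]] /=.
      by exists [::]; first by rewrite pi_nil; exact: subgroup1.
    exists (u ++ word_inv v); last by rewrite pi_cat pi_word_inv.
    rewrite pi_cat pi_word_inv.
    have sD := subgroup_commutator_subgroup G.
    exact: subgroupM sD Du (subgroupV sD Dv).
  move=> _ [p _ [q _ <-]].
  elim/quotW: p => u; elim/quotW: q => v.
  exists (word_inv u ++ word_inv v ++ u ++ v).
    by rewrite !pi_cat !pi_word_inv; exact: commutator_subgroupR.
  by rewrite !pi_cat !pi_word_inv.
have abQ : forall p q : Q, commute p q.
  apply: meta => [u v Ruv|_ _ /lift[u Du <-] /lift[v Dv <-]].
    apply: word_eq_rel; rewrite /quotient_rel.
    suff -> : \pi_G u = \pi_G v by rewrite mulgV; exact: subgroup1.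
    by apply/presented_eqP; exact: word_eq_rel.
  rewrite /commute -!pi_cat; apply/presented_eqP/word_eq_rel.
  rewrite /quotient_rel !pi_cat invgM !mulgA.
  rewrite -[X in N X]invgK; apply: (subgroupV sN).
  have -> : (\pi_G u * \pi_G v / \pi_G u / \pi_G v)^-1 =
      [~ (\pi_G v)^-1, (\pi_G u)^-1].
    by rewrite /commg /conjg !invgM !invgK !mulgA.
  by apply: derivedR; exact: (subgroupV (subgroup_commutator_subgroup _)).
elim/quotW: x => u; elim/quotW: y => v.
have /presented_eqP/(word_eq_quotient_rel sN nN) :
    \pi_(presented (quotient_rel N)) (v ++ u) =
    \pi_(presented (quotient_rel N)) (u ++ v).
  by rewrite !pi_cat; exact: abQ.
(* Conjugation by v u turns (v u) (u v)^-1 into the inverse of [u, v]. *)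
rewrite /quotient_rel !pi_cat => /(nN (\pi_G v * \pi_G u)).
rewrite /conjg -[X in _ * X]mulgA mulKg => /(subgroupV sN).
by rewrite invgM invgK /commg /conjg invgM -!mulgA.
Qed.

End Quotient.

(** * Alternating products, the two sides of an Artin relation *)

Section AlternatingProducts.
Local Open Scope group_scope.
Variable G : groupType.
Implicit Types a b : G.

Fixpoint alt_prod (m : nat) a b : G :=
  if m is m'.+1 then a * alt_prod m' b a else 1.

Lemma alt_prodSr m a b :
  alt_prod m.+1 a b = alt_prod m a b * (if odd m then b else a).
Proof.
elim: m a b => [|m IHm] a b; first by rewrite /= mulg1 mul1g.
rewrite -[LHS]/(a * alt_prod m.+1 b a) IHm /= mulgA.
by case: (odd m).
Qed.

Lemma alt_prod2_commute a b : alt_prod 2 a b = alt_prod 2 b a -> commute a b.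
Proof. by rewrite /= !mulg1. Qed.

(** Let g be the alternating product of the first m - 1 factors b a b ...; as m - 1 is even, a g and
    g b are the two sides of the relation. *)
Lemma alt_prod_odd_conjg m a b :
  odd m -> alt_prod m a b = alt_prod m b a -> exists g, a ^ g = b.
Proof.
case: m => // m /= /negbTE modd eq_ab; exists (alt_prod m b a).
rewrite /conjg; have := alt_prodSr m b a.
by rewrite modd /= -eq_ab => ->; rewrite mulKg.
Qed.

(** Cancelling pairs [a * b] reduces each side to a single factor. *)
Lemma alt_prod_odd_commute m a b :
  odd m -> alt_prod m a b = alt_prod m b a -> commute a b -> a = b.
Proof.
move=> odd_m eq_ab ab; move: eq_ab; rewrite -(odd_double_half m) odd_m.
elim: m./2 => [|k IHk]; first by rewrite /= !mulg1.
move=> E; apply: IHk; apply: (mulgI (a * b)).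
by rewrite [in RHS]ab -!mulgA; exact: E.
Qed.

End AlternatingProducts.

(** * Families of Artin generators in a metabelian group *)

Section ArtinFamilies.
Local Open Scope classical_set_scope.
Local Open Scope group_scope.
Variable G : groupType.
Implicit Types (l : nat -> nat -> nat) (a : nat -> G) (n : nat) (s : G).

Definition artin_family l n a := forall p q, 0 < p -> p < q -> q <= n ->
  alt_prod (l p q) (a p) (a q) = alt_prod (l p q) (a q) (a p).

(** The family together with [s] generates [G]. The extra element is [1] except in type B, where it
    is the last generator, attached by the edge labelled 4. *)
Definition spanning n a s := forall H : set G, subgroup H -> H s ->
  (forall p, 0 < p -> p <= n -> H (a p)) -> forall x, H x.

(** Odd labels make the joined generators conjugate; the smaller neighbour allows induction on the
    vertex. *)
Definition odd_tree l n :=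
  forall q, 1%N < q -> q <= n -> exists p, [/\ 0 < p, p < q & odd (l p q)].

Lemma artin_family2 l n a p q : artin_family l n a ->
  0 < p -> p < q -> q <= n -> l p q = 2 -> commute (a p) (a q).
Proof.
by move=> ra p0 pq qn lpq; apply: alt_prod2_commute; have := ra p q p0 pq qn; rewrite lpq.
Qed.

(** An odd relation conjugates [a p] to [a q], so [a q / a p] is a commutator; going down the tree
    multiplies such commutators. *)
Lemma commutator_subgroup_ratio l n a : artin_family l n a -> odd_tree l n ->
  forall q, 0 < q -> q <= n -> commutator_subgroup G (a q / a 1%N).
Proof.
move=> ra tree; elim/ltn_ind => q IHq q0 qn.
have [->|q1] := eqVneq q 1%N; first by rewrite mulgV; exact: subgroup1.
have [||p [p0 pq lpq]] := tree q => //; first by lia.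
have [g gE] := alt_prod_odd_conjg lpq (ra _ _ p0 pq qn).
have -> : a q / a 1%N = [~ g, (a p)^-1] * (a p / a 1%N).
  by rewrite -gE /commg /conjg !invgK !mulgA mulgVK.
have sD := subgroup_commutator_subgroup G.
apply: (subgroupM sD (commutator_subgroupR _ _)).
by apply: IHq => //; lia.
Qed.

Hypothesis metabelian : forall x y, commutator_subgroup G x ->
  commutator_subgroup G y -> commute x y.

(** Each [a p] is an element of G' times [a k], and [x] commutes with both factors. *)
Lemma metabelian_central n a s k x : spanning n a s -> 0 < k -> k <= n ->
    (forall q, 0 < q -> q <= n -> commutator_subgroup G (a q / a 1%N)) ->
    commutator_subgroup G x -> commute x (a k) -> commute x s ->
  forall y, commute x y.
Proof.
move=> span k0 kn Da Dx xk xs y.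
have sC := subgroup_centraliser [set x].
suff: [set g | forall h, [set x] h -> commute h g] y by apply.
apply: (span _ sC) => [_ -> //|p p0 pn _ ->].
have -> : a p = a p / a 1%N / (a k / a 1%N) * a k.
  by rewrite invgF mulgA mulgVK mulgVK.
have sD := subgroup_commutator_subgroup G.
apply: commuteM => //; apply: metabelian => //.
by apply: (subgroupM sD); [|apply: (subgroupV sD)]; exact: Da.
Qed.

(* For [q > 2] some generator [a p], [p < q], commutes with [a q]; as
   [a p = a 1] by induction and [a q] is braided with another copy of [a 1], it
   suffices to identify [a 1] and [a 2]. *)
Lemma metabelian_artin_abelian l n a s k :
    artin_family l n a -> odd_tree l n -> spanning n a s ->
    (forall q, 2 < q -> q <= n -> exists p, [/\ 0 < p, p < q & l p q = 2]) ->
    2 < k -> k <= n -> l 1%N k = 2 -> l 2 k = 2 ->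
    commute (a 1%N) s -> commute (a 2) s ->
  forall x y : G, commute x y.
Proof.
move=> ra tree span far k2 kn l1k l2k a1s a2s.
have Da := commutator_subgroup_ratio ra tree.
have sD := subgroup_commutator_subgroup G.
have a1k : commute (a 1%N) (a k).
  by apply: (artin_family2 ra) => //; lia.
have a2k : commute (a 2) (a k).
  by apply: (artin_family2 ra) => //; lia.
have cx : forall y, commute (a 2 / a 1%N) y.
  apply: (metabelian_central span (k := k)) => //; try lia.
  - by apply: Da => //; lia.
  - by apply/commute_sym/commuteM; [|apply: commuteV]; exact: commute_sym.
  - by apply/commute_sym/commuteM; [|apply: commuteV]; exact: commute_sym.
have a12 : commute (a 1%N) (a 2).
  have -> : a 2 = a 2 / a 1%N * a 1%N by rewrite mulgVK.
  by apply: commuteM; [exact: commute_sym | exact: commute_refl].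
have aE : forall q, 0 < q -> q <= n -> a q = a 1%N.
  elim/ltn_ind => q IHq q0 qn; have [->//|q1] := eqVneq q 1%N.
  have [||p [p0 pq lpq]] := tree q => //; first by lia.
  have <- : a p = a 1%N by apply: IHq => //; lia.
  apply/esym/(alt_prod_odd_commute lpq (ra _ _ p0 pq qn)).
  have -> : a p = a 1%N by apply: IHq => //; lia.
  have [->//|q2] := eqVneq q 2.
  have [||p' [p'0 p'q lp'q]] := far q => //; first by lia.
  have <- : a p' = a 1%N by apply: IHq => //; lia.
  exact: (artin_family2 ra).
have sC (S : set G) := subgroup_centraliser S.
(* All [a p] being equal to [a 1], the commuting elements [a 1] and [s] generate the group. *)
have a1y y : commute (a 1%N) y.
  suff: [set g | forall h, [set a 1%N] h -> commute h g] y by apply.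
  by apply: (span _ (sC _)) => [_ -> //|p p0 pn _ ->]; rewrite aE.
move=> x y; suff: [set g | forall h, [set: G] h -> commute h g] y by apply.
apply: (span _ (sC _)) => [h _|p p0 pn h _]; last first.
  by rewrite aE //; exact: commute_sym.
apply: commute_sym.
suff: [set g | forall h, [set s] h -> commute h g] h by apply.
apply: (span _ (sC _)) => [_ -> //|p p0 pn _ ->].
by rewrite aE //; exact: commute_sym.
Qed.

(* Here [a 1 / a 3] is central because it commutes with [a 3]. *)
Lemma metabelian_H3_abelian a :
    artin_family labelH 3 a -> spanning 3 a 1 ->
  forall x y : G, commute x y.
Proof.
move=> ra span; have tree : odd_tree labelH 3.
  by case=> [|[|[|[|q]]]] // _ _; [exists 1%N | exists 2].
have Da := commutator_subgroup_ratio ra tree.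
have sD := subgroup_commutator_subgroup G.
have a13 : commute (a 1%N) (a 3) by apply: (artin_family2 ra).
have cu : forall y, commute (a 1%N / a 3) y.
  apply: (metabelian_central span (k := 3)) => //.
  - rewrite -[X in commutator_subgroup _ X]invgK invgF.
    by apply: (subgroupV sD); exact: Da.
  - apply/commute_sym/commuteM; first exact: commute_sym.
    by apply: commuteV; exact: commute_refl.
  - exact: commute1.
have a1E : a 1%N = a 1%N / a 3 * a 3 by rewrite mulgVK.
move: (a 1%N / a 3) cu a1E => u cu a1E.
have := ra 2 3 isT isT isT; rewrite /= !mulg1; set b := a 2; set c := a 3.
move=> bcb.
(* With [a 1 = u * c] and [u] central, the relation of length five becomes u c b c b c = b c b c b;
   replacing c b c by b c b on the left, and the last b c b by c b c on the right, leaves u b =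
   c. *)
have := ra 1%N 2 isT isT isT; rewrite /= !mulg1 a1E -/b -/c -!mulgA.
have uC y z : y * (u * z) = u * (y * z) by rewrite !mulgA cu.
rewrite !(uC b) !(uC c) => /mulgI; rewrite !(uC b) !(uC c) => /mulgI.
have bcbA z : b * (c * (b * z)) = c * (b * (c * z)).
  by rewrite !mulgA -(mulgA b) bcb !mulgA.
rewrite -bcbA bcb -(uC b) -(uC c) => /mulgI/mulgI.
rewrite !mulgA => /mulIg/mulIg ub.
(* Since c = u b with [u] central, [b] and [c] commute; their braid relation makes them equal,
   whence u = 1. *)
have bc : commute b c.
  rewrite -ub; apply: commuteM; last exact: commute_refl.
  exact/commute_sym/cu.
have b_c : b = c by apply: (@alt_prod_odd_commute _ 3) => //=; rewrite !mulg1.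
have u1 : u = 1 by apply: (mulIg b); rewrite mul1g ub.
have aE q : 0 < q -> q <= 3 -> a q = c.
  by case: q => [|[|[|[|q]]]] // _ _; rewrite a1E u1 mul1g.
have sC (S : set G) := subgroup_centraliser S.
have cc y : commute c y.
  suff: [set g | forall h, [set c] h -> commute h g] y by apply.
  apply: (span _ (sC _)) => [h _|p p0 pn _ ->]; first exact: commute1.
  by rewrite aE //; exact: commute_refl.
move=> x y; suff: [set g | forall h, [set: G] h -> commute h g] y by apply.
apply: (span _ (sC _)) => [h _|p p0 pn h _]; first exact: commute1.
by rewrite aE //; exact: commute_sym.
Qed.
End ArtinFamilies.

(** * Finite generation of the commutator subgroup *)

Section FiniteGeneration.
Local Open Scope classical_set_scope.
Local Open Scope group_scope.
Variable G : groupType.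
Implicit Types (l : nat -> nat -> nat) (a : nat -> G) (n : nat) (s t x : G).

(** Moving every [t] to the left by [y * t = t * y ^ t] turns the relation into
    [(x ^ t) ^ t * x = x ^ t]. In the application [x * t] is a generator [a p]. *)
Lemma braid_conjg x t : alt_prod 3 (x * t) t = alt_prod 3 t (x * t) ->
  (x ^ t) ^ t = x ^ t / x /\ x ^ t^-1 = (x ^ t)^-1 * x.
Proof.
move=> xt.
have conjgCA y z : y * (t * z) = t * (y ^ t * z) by rewrite mulgA (conjgC y t) -mulgA.
rewrite /= !mulg1 -!mulgA !(conjgCA x) !(conjgCA (x ^ t)) in xt.
have E : (x ^ t) ^ t * x = x ^ t.
  by move/mulgI/mulgI: xt; rewrite (mulgA _ x t) => /mulIg.
split; first by apply: (mulIg x); rewrite E mulgVK.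
by apply: (conjg_inj t); rewrite conjgKV conjMg conjVg -{2}E mulKg.
Qed.

(** The same shift, now of [s], gives [(x ^ s) ^ s * x ^ s = x ^ s * x]. *)
Lemma square_conjg x s : alt_prod 4 x s = alt_prod 4 s x ->
  (x ^ s) ^ s = x ^ s * x / x ^ s /\ x ^ s^-1 = (x ^ s) ^ x.
Proof.
move=> xs.
have conjgCA y z : y * (s * z) = s * (y ^ s * z) by rewrite mulgA (conjgC y s) -mulgA.
rewrite /= !mulg1 (conjgC x s) !(conjgCA x) !(conjgCA (x ^ s)) in xs.
have E : (x ^ s) ^ s * x ^ s = x ^ s * x by move/mulgI/mulgI: xs.
split; first by apply: (mulIg (x ^ s)); rewrite E mulgVK.
apply: (conjg_inj s); rewrite conjgKV conjJg.
by rewrite [RHS]/conjg E mulKg.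
Qed.

(** With [c] the inverse of [a r], this carries the relation of length four from [a p] over to
    [a p / a r]. *)
Lemma alt_prod4_mulr c x s : commute c x -> commute c s ->
  alt_prod 4 (x * c) s = alt_prod 4 x s * (c * c) /\
  alt_prod 4 s (x * c) = alt_prod 4 s x * (c * c).
Proof.
move=> cx cs.
have cxA z : c * (x * z) = x * (c * z) by rewrite !mulgA cx.
have csA z : c * (s * z) = s * (c * z) by rewrite !mulgA cs.
by split; rewrite /= !mulg1 -!mulgA ?cs !csA !cxA ?csA.
Qed.

(** Lets commutation modulo a normal subgroup be checked on generators through [spanning]. *)
Lemma subgroup_centraliser_mod (S H : set G) : subgroup H ->
    (forall g h, H h -> H (h ^ g)) ->
  subgroup [set g | forall h, S h -> H [~ h, g]].
Proof.
move=> sH nH; split=> /= [h _|x y Cx Cy h Sh].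
  by rewrite commg1; exact: subgroup1.
have -> : [~ h, x / y] = ([~ h, y]^-1 * [~ h, x]) ^ y^-1.
  by rewrite /commg /conjg !invgM !invgK !mulgA mulgV mul1g mulgK.
apply/nH/(subgroupM sH); last exact: Cx.
by apply: (subgroupV sH); exact: Cy.
Qed.

Lemma conjg_fixed x g : commute x g -> x ^ g = x.
Proof. by move=> xg; rewrite /conjg xg mulKg. Qed.

(** Only [t] may move [x] here; when it is [s] that moves [x], the lemma is applied with [t] and [s]
    exchanged. *)
Lemma conjg_closed_step (H : set G) x t s y : commute t s -> commute x s ->
    H x -> H (x ^ t) -> H (x ^ t^-1) -> H ((x ^ t) ^ t) ->
    [\/ y = x, y = x ^ t | y = x ^ s] ->
  [/\ H (y ^ t), H (y ^ t^-1), H (y ^ s) & H (y ^ s^-1)].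
Proof.
move=> ts xs Hx Hxt HxtV Hxtt.
have xsE : x ^ s = x := conjg_fixed xs.
have xsVE : x ^ s^-1 = x := conjg_fixed (commuteV xs).
have xtsE : (x ^ t) ^ s = x ^ t by rewrite -conjgM ts conjgM xsE.
have xtsVE : (x ^ t) ^ s^-1 = x ^ t by rewrite -{1}xtsE conjgK.
by case=> ->; rewrite ?xsE ?xtsE ?xtsVE ?conjgK ?xsE ?xsVE.
Qed.

(* The conjugates of [x p = a p / a r] under powers of [a r] and of [s] generate
   the commutator subgroup; by [braid_conjg] and [square_conjg], those by [1],
   [a r] and [s] suffice. *)
Lemma commutator_subgroup_fg n a s r :
    spanning n a s -> 0 < r -> r <= n -> commute (a r) s ->
    (forall p, 0 < p -> p <= n -> commutator_subgroup G (a p / a 1%N)) ->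
    (forall p, 0 < p -> p <= n ->
       [\/ commute (a p) (a r) /\ commute (a p) s,
           alt_prod 3 (a p) (a r) = alt_prod 3 (a r) (a p) /\ commute (a p) s |
           commute (a p) (a r) /\ alt_prod 4 (a p) s = alt_prod 4 s (a p)]) ->
  finitely_generated (commutator_subgroup G).
Proof.
move=> span r0 rn ts Da local_rel; set t := a r in ts local_rel *.
have sD := subgroup_commutator_subgroup G.
pose X := [set a p / t | p in [set p | 0 < p <= n]].
pose S := X `|` [set x ^ t | x in X] `|` [set x ^ s | x in X].
have finX : finite_set X.
  by apply: finite_image; apply: (sub_finite_set _ (finite_II n.+1)) => p /= /andP[].
exists S; first by rewrite /S !finite_setU; split; [split|]; do ?exact: finite_image.
have sS : subgroup (generated S) := subgroup_generated S.
have SX p : 0 < p -> p <= n -> let x := a p / t in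
    [/\ generated S x, generated S (x ^ t) & generated S (x ^ s)].
  move=> p0 pn x; have Xx : X x by exists p => //=; rewrite p0.
  split; apply: sub_gen_smallest; last by right; exists x.
    by left; left.
  by left; right; exists x.
have step y : S y -> [/\ generated S (y ^ t), generated S (y ^ t^-1),
                         generated S (y ^ s) & generated S (y ^ s^-1)].
  move=> Sy; have [p [p0 pn yE]] : exists p, [/\ 0 < p, p <= n &
      [\/ y = a p / t, y = (a p / t) ^ t | y = (a p / t) ^ s]].
    by case: Sy => [[[p /= /andP[p0 pn] <-]|[_ [p /= /andP[p0 pn] <-] <-]]|
      [_ [p /= /andP[p0 pn] <-] <-]]; exists p; split=> //; constructor.
  move: yE; have [] := SX p p0 pn; set x := a p / t => Sx Sxt Sxs yE.
  have xt : commute (a p) t -> commute x t.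
    move=> pt; apply/commute_sym/commuteM; first exact: commute_sym.
    exact/commuteV/commute_refl.
  have xs : commute (a p) s -> commute x s.
    by move=> ps; apply/commute_sym/commuteM; [|apply: commuteV]; exact: commute_sym.
  case: (local_rel p p0 pn) => [[/xt xt' /xs xs']|[ptp /xs xs']|[pt psp]];
    last have xt' := xt pt.
  - apply: (conjg_closed_step (x := x)) => //.
      by rewrite conjg_fixed //; exact: commuteV.
    by rewrite !conjg_fixed.
  - have [|xtt xtV] := @braid_conjg x t; first by rewrite mulgVK.
    apply: (conjg_closed_step (x := x)); rewrite ?xtt ?xtV //.
      by apply: (subgroupM sS) => //; exact: (subgroupV sS).
    by apply: (subgroupM sS) => //; exact: (subgroupV sS).
  - have [|xss xsV] := @square_conjg x s.
      have [tVp tVs] : commute t^-1 (a p) /\ commute t^-1 s.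
        by split; apply/commute_sym/commuteV => //; exact: commute_sym.
      by have [-> ->] := alt_prod4_mulr tVp tVs; rewrite psp.
    suff [] : [/\ generated S (y ^ s), generated S (y ^ s^-1),
                  generated S (y ^ t) & generated S (y ^ t^-1)] by [].
    apply: (conjg_closed_step (x := x)); rewrite ?xss ?xsV //.
    + exact: (subgroupM sS (subgroupV sS Sx) (subgroupM sS Sxs Sx)).
    + exact: (subgroupM sS (subgroupM sS Sxs Sx) (subgroupV sS Sxs)).
    + by case: yE => ->; constructor.
(* The normaliser of [generated S] contains [t], [s] and each [a p = a p / t * t], so [generated S]
   is normal. *)
have sN := subgroup_normaliser (generated S).
have Nt : [set g | forall h, generated S h ->
    generated S (h ^ g) /\ generated S (h ^ g^-1)] t.
  by move=> h Sh; split; apply: generated_conjg Sh => y /step[].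
have Ns : [set g | forall h, generated S h ->
    generated S (h ^ g) /\ generated S (h ^ g^-1)] s.
  by move=> h Sh; split; apply: generated_conjg Sh => y /step[].
have nS g h : generated S h -> generated S (h ^ g).
  move=> Sh; suff /(_ h Sh)[] : [set g | forall h, generated S h ->
    generated S (h ^ g) /\ generated S (h ^ g^-1)] g by [].
  apply: (span _ sN Ns) => p p0 pn.
  have -> : a p = a p / t * t by rewrite mulgVK.
  apply: (subgroupM sN) Nt => k Sk; rewrite /conjg invgK.
  have [Sx _ _] := SX p p0 pn.
  by split; do ?apply: (subgroupM sS) => //; exact: (subgroupV sS).
apply/seteqP; split.
  apply: generated_sub => // _ [x _ [y _ <-]].
  have SC (K : set G) k : generated S k ->
      forall h, K h -> generated S [~ h, k].
    move=> Sk h _; rewrite commgEr; apply: (subgroupM sS) => //.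
    exact: nS (subgroupV sS Sk).
  have sC (K : set G) := subgroup_centraliser_mod K sS nS.
  have aE p : a p = a p / t * t by rewrite mulgVK.
  (* Modulo [generated S] each [a p] becomes [t], so the quotient is generated by the commuting
     elements [t] and [s] and is abelian. *)
  have tsC g : forall h, [set t; s] h -> generated S [~ h, g].
    move: g; apply: (span _ (sC _)) => [h hts|p p0 pn].
      suff -> : [~ h, s] = 1 by exact: subgroup1.
      apply/eqP/commgP; case: hts => -> //; exact: commute_refl.
    rewrite aE; apply: (subgroupM (sC _)).
      by apply: SC; case: (SX p p0 pn).
    move=> h hts; suff -> : [~ h, t] = 1 by exact: subgroup1.
    by apply/eqP/commgP; case: hts => -> //; exact: commute_refl.
  suff: [set g | forall h, [set: G] h -> generated S [~ h, g]] y by apply.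
  apply: (span _ (sC _)) => [h _|p p0 pn].
    by rewrite -invgR; apply: (subgroupV sS); apply: tsC; right.
  rewrite aE; apply: (subgroupM (sC _)).
    by apply: SC; case: (SX p p0 pn).
  by move=> h _; rewrite -invgR; apply: (subgroupV sS); apply: tsC; left.
apply: generated_sub => // y Sy.
have SD p : 0 < p -> p <= n -> commutator_subgroup G (a p / t).
  move=> p0 pn; have -> : a p / t = a p / a 1%N / (t / a 1%N).
    by rewrite invgF mulgA mulgVK.
  by apply: (subgroupM sD); [|apply: (subgroupV sD)]; exact: Da.
case: Sy => [[[p /= /andP[p0 pn] <-]|[_ [p /= /andP[p0 pn] <-] <-]]|
      [_ [p /= /andP[p0 pn] <-] <-]]; do ?apply: commutator_subgroup_conjg; exact: SD.
Qed.
End FiniteGeneration.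

(** * The generators of a presented group as an Artin family *)

Section PresentedArtinFamily.
Local Open Scope group_scope.
Local Open Scope quotient_scope.
Variables (n : nat) (l : nat -> nat -> nat) (l_ge2 : forall p q, 1 < l p q).
Variable S : word 'I_n -> word 'I_n -> Prop.

Lemma pi_alt_word m i j : \pi_(presented S) (alt_word m i j) =
  alt_prod m (\pi_(presented S) [:: (i, false)]) (\pi_(presented S) [:: (j, false)]).
Proof. by elim: m i j => //= m IHm i j; rewrite -IHm -pi_cat. Qed.

(** Any [S] that implies the Artin relations is allowed, so that the Artin group and its quotients
    are treated alike. *)
Lemma presented_artin_family :
    (forall u v, artin_rel (mk_coxeter_graph n l_ge2) u v -> word_eq S u v) ->
  exists2 a : nat -> presented S, artin_family l n a & spanning n a 1.
Proof.
move=> artinS.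
(* Vertex p is the ordinal of value p - 1; beyond [n] the family takes the default value [1]. *)
pose a p := if insub p.-1 is Some i then \pi_(presented S) [:: (i : 'I_n, false)]
            else 1.
have aE (i : 'I_n) : a i.+1 = \pi_(presented S) [:: (i, false)].
  by rewrite /a /= valK.
exists a => [[|p] [|q] // _ pq qn|H sH _ Ha].
  have pn : p < n by lia.
  rewrite (aE (Ordinal pn)) (aE (Ordinal qn)) -!pi_alt_word.
  apply/presented_eqP/artinS; apply: ArtinRel.
    by apply/eqP => -[]; lia.
  by rewrite /= /mk_label /= (minn_idPl _) ?(maxn_idPr _) //; lia.
elim/quotW; elim=> [|[i b] w IHw]; first exact: (subgroup1 sH).
rewrite -cat1s pi_cat; apply: (subgroupM sH) IHw.
have Hi : H (\pi_(presented S) [:: (i, false)]) by rewrite -aE; apply: Ha.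
by case: b => //; rewrite (pi_word_inv S [:: (i, false)]); exact: (subgroupV sH).
Qed.

End PresentedArtinFamily.

(* The generator [i] acts by the reflection [v j |-> v j] ([j <> i]),
   [v i |-> - v i + \sum_(k <> i) c i k * v k], with [c i k = 2 cos (pi / m_ik)]
   for [m_ik = 2, 3, 5]; [phi] is the golden ratio [2 cos (pi / 5)]. For
   [m_ik = 4] we put [c i k = 0]: commuting elements satisfy the relation. *)
Section ReflectionAction.
Local Open Scope ring_scope.
Variables (K : comNzRingType) (phi : K) (phiE : phi ^+ 2 = phi + 1).
Variables (n : nat) (Gamma : coxeter_graph n).
Hypothesis labels : forall i j m, i != j -> cox_label Gamma i j = Some m ->
  m \in [:: 2; 3; 4; 5]%N.
Implicit Types (i j k : 'I_n) (v : 'I_n -> K).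

Definition refl_coef i k : K :=
  if cox_label Gamma i k == Some 3 then 1
  else if cox_label Gamma i k == Some 5 then phi else 0.

Definition refl i v j : K :=
  if j == i then - v i + \sum_(k | k != i) refl_coef i k * v k else v j.

(** The sign of a letter is dropped because reflections are involutions. *)
Definition refl_word (w : word 'I_n) v : 'I_n -> K :=
  foldr (fun x => refl x.1) v w.

Definition upd2 i j v (x y : K) k := if k == i then x else if k == j then y else v k.

Lemma upd2C i j v x y : i != j -> upd2 i j v x y = upd2 j i v y x.
Proof.
move=> ij; apply: funext => k; rewrite /upd2.
by have [->|] := eqVneq k i; rewrite ?(negbTE ij).
Qed.

Lemma upd2_id i j v : upd2 i j v (v i) (v j) = v.
Proof. by apply: funext => k; rewrite /upd2; do 2![case: eqP => [->//|_]]. Qed.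

(** The reflections [i] and [j] change only these two coordinates; the others enter through a
    constant sum, so an Artin relation becomes an identity between pairs. *)
Lemma refl_upd2 i j v x y : i != j -> refl i (upd2 i j v x y) =
  upd2 i j v (- x + (refl_coef i j * y +
                     \sum_(k | (k != i) && (k != j)) refl_coef i k * v k)) y.
Proof.
move=> ij; apply: funext => k; rewrite /refl.
rewrite [in RHS]/upd2; case: (eqVneq k i) => [_|ki]; last first.
  by rewrite /upd2 (negbTE ki).
rewrite (bigD1 j) 1?eq_sym //= /upd2 eqxx (negbTE (_ : j != i)) 1?eq_sym //.
rewrite eqxx; congr (_ + (_ + _)); apply: eq_bigr => h /andP[hi hj].
by rewrite (negbTE hi) (negbTE hj).
Qed.

Lemma reflK i : involutive (refl i).
Proof.
move=> v; apply: funext => j; rewrite {1}/refl.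
case: (eqVneq j i) => [->|ji]; last by rewrite /refl (negbTE ji).
rewrite {1}/refl eqxx; set s := \sum_(_ | _) _; set s' := \sum_(_ | _) _.
have -> : s' = s by apply: eq_bigr => k ki; rewrite /refl (negbTE ki).
by ring.
Qed.

Lemma refl_coefC i j : refl_coef i j = refl_coef j i.
Proof. by rewrite /refl_coef cox_label_sym. Qed.

(** On the two coordinates each relation is a polynomial identity, which for [m = 5] holds modulo
    [phiE]. *)
Lemma refl_alt_word i j m v : i != j -> cox_label Gamma i j = Some m ->
  refl_word (alt_word m i j) v = refl_word (alt_word m j i) v.
Proof.
move=> ij lij; have ji : j != i by rewrite eq_sym.
have := labels ij lij; rewrite -(upd2_id i j v).
have reflj x y := etrans (congr1 (refl j) (upd2C v x y ij)) (refl_upd2 v y x ji).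
rewrite -(refl_coefC i j) in reflj.
move: (v i) (v j) => x y; rewrite !inE => /or4P[] /eqP mE;
  rewrite mE in lij *; rewrite /refl_word /=;
  rewrite !(refl_upd2, reflj, upd2C _ _ _ ji) //; 
  rewrite /refl_coef lij /=; congr upd2; ring: phiE.
Qed.

Lemma refl_word_eq (s t : word 'I_n) :
  word_eq (artin_rel Gamma) s t -> refl_word s = refl_word t.
Proof.
have catE (u w : word 'I_n) x : refl_word (u ++ w) x = refl_word u (refl_word w x).
  by rewrite /refl_word foldr_cat.
elim=> {s t} //.
- by move=> u w t _ -> _ ->.
- move=> u u1 w w1 _ uE _ wE; apply: funext => x.
  by rewrite !catE uE wE.
- by move=> i b; apply: funext => v; rewrite /refl_word /= reflK.
- move=> _ _ [i j m ij lij]; apply: funext => v; exact: refl_alt_word.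
Qed.

Local Open Scope quotient_scope.

Lemma artin_group_nonabelian i j : i != j -> cox_label Gamma i j = Some 3 ->
  exists x y : artin_group Gamma, ~ commute x y.
Proof.
move=> ij lij; have ji : j != i by rewrite eq_sym.
exists (\pi_(presented (artin_rel Gamma)) [:: (i, false)]).
exists (\pi_(presented (artin_rel Gamma)) [:: (j, false)]).
rewrite /commute -!pi_cat => /presented_eqP/refl_word_eq.
(* On the vector with 1 at [j] and 0 elsewhere, coordinate [j] becomes -1 when [refl j] acts first
   and 0 when [refl i] does. *)
move/(congr1 (fun f => f (upd2 i j (fun=> 0) 0 1) j)).
rewrite /refl_word /= refl_upd2 // !(upd2C _ _ _ ij) !refl_upd2 // (upd2C _ _ _ ji).
rewrite refl_upd2 //.
rewrite /refl_coef (cox_label_sym Gamma j) lij /= /upd2 eqxx (negbTE ji).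
have sum0 (P : pred 'I_n) F : \sum_(k | P k) F k * 0 = 0 :> K.
  by apply: big1 => k _; rewrite mulr0.
rewrite !sum0 => /addrI/esym/eqP.
by rewrite mulr0 oppr0 !addr0 add0r !mul1r oner_eq0.
Qed.

End ReflectionAction.

(** * Criteria that can be read off the labels *)

Section Criteria.
Local Open Scope group_scope.
Variables (n : nat) (l : nat -> nat -> nat) (l_ge2 : forall p q, 1 < l p q).
Local Notation Gamma := (mk_coxeter_graph n l_ge2).

Definition far_below m :=
  forall q, 2 < q -> q <= m -> exists p, [/\ 0 < p, p < q & l p q = 2].

Lemma artin_group_family :
  exists2 a : nat -> artin_group Gamma, artin_family l n a & spanning n a 1.
Proof. by apply: presented_artin_family => u v; exact: word_eq_rel. Qed.

(** For type B: the last generator leaves the family and becomes the extra element. *)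
Lemma spanning_pred (G : groupType) m (a : nat -> G) :
  spanning m.+1 a 1 -> spanning m a (a m.+1).
Proof.
move=> span H sH Ha Hm; apply: span => //; first exact: (subgroup1 sH).
move=> p p0; rewrite leq_eqVlt => /orP[/eqP-> //|pm].
by apply: Hm; lia.
Qed.

Lemma artin_perfect k : odd_tree l n -> far_below n ->
    2 < k -> k <= n -> l 1%N k = 2 -> l 2 k = 2 ->
  perfect (commutator_subgroup (artin_group Gamma)).
Proof.
move=> tree far k2 kn l1k l2k.
apply: perfect_commutator_subgroup => S artinS metaS.
have [a ra span] := presented_artin_family artinS.
by apply: (metabelian_artin_abelian metaS ra tree span far k2 kn l1k l2k);
  exact: commute1.
Qed.

(** With [s = 1], every generator commutes or is braided with [a r], which gives the first two cases
    of [commutator_subgroup_fg]. *)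
Lemma artin_fg r : odd_tree l n -> 0 < r -> r <= n ->
    (forall p, 0 < p -> p < r -> l p r = 2 \/ l p r = 3) ->
    (forall p, r < p -> p <= n -> l r p = 2 \/ l r p = 3) ->
  finitely_generated (commutator_subgroup (artin_group Gamma)).
Proof.
move=> tree r0 rn lpr lrp; have [a ra span] := artin_group_family.
apply: (commutator_subgroup_fg span r0 rn (commute1 _)).
  exact: commutator_subgroup_ratio ra tree.
move=> p p0 pn; have := ra p r; have := ra r p.
case: (ltngtP p r) => [pr _ /(_ p0 isT rn)|rp /(_ r0 isT pn) + _|->]; last first.
- by constructor 1; split; [exact: commute_refl | exact: commute1].
- case: (lrp p rp pn) => -> /esym prE.
    by constructor 1; split; [exact: alt_prod2_commute | exact: commute1].
  by constructor 2; split=> //; exact: commute1.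
- case: (lpr p p0 pr) => -> prE.
    by constructor 1; split; [exact: alt_prod2_commute | exact: commute1].
  by constructor 2; split=> //; exact: commute1.
Qed.

Lemma artin_not_locally_indicable p q :
    0 < p -> p < q -> q <= n -> l p q = 3 ->
    (forall p q, l p q \in [:: 2; 3; 4; 5]) ->
    finitely_generated (commutator_subgroup (artin_group Gamma)) ->
    perfect (commutator_subgroup (artin_group Gamma)) ->
  ~ locally_indicable (artin_group Gamma).
Proof.
move=> p0 pq qn lpq labels fg perf.
apply: (not_locally_indicable_perfect _ fg perf) => // G1.
(* Modulo 5, 9 = 4 = 3 + 1, so 3 serves as the golden ratio. *)
have phiE : (3%:R ^+ 2 = 3%:R + 1 :> 'F_5)%R by apply/eqP.
have pn : p.-1 < n by lia.
have qn' : q.-1 < n by lia.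
have ij : Ordinal pn != Ordinal qn' by apply/eqP => -[]; lia.
have lij : cox_label Gamma (Ordinal pn) (Ordinal qn') = Some 3.
  by rewrite /= /mk_label /= (minn_idPl _) ?(maxn_idPr _) ?prednK ?lpq //; lia.
have Gl i j m : i != j -> cox_label Gamma i j = Some m -> m \in [:: 2; 3; 4; 5].
  by move=> _ [<-].
have [x [y]] := artin_group_nonabelian phiE Gl ij lij.
apply; apply/commgP/eqP.
have : commutator_subgroup _ [~ x, y] := commutator_subgroupR x y.
by rewrite G1.
Qed.

End Criteria.

(** * The five types *)

Lemma typeA_fg_perfect n : 4 <= n ->
  finitely_generated (commutator_subgroup (artin_group (typeA n))) /\
  perfect (commutator_subgroup (artin_group (typeA n))).
Proof.
move=> n4; have tree : odd_tree labelA n.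
  by move=> q q1 qn; exists q.-1; rewrite /labelA; split; [| |case: ifP]; lia.
split.
  apply: (artin_fg _ (r := 1)) => // [|p p0 p1|p p1 pn]; try lia.
  by rewrite /labelA; case: ifP; [right | left].
apply: (artin_perfect _ (k := 4) tree) => // q q2 qn.
by exists 1; rewrite /labelA; split; [| |case: ifP]; lia.
Qed.

Lemma typeB_fg_perfect n : 5 <= n ->
  finitely_generated (commutator_subgroup (artin_group (typeB n))) /\
  perfect (commutator_subgroup (artin_group (typeB n))).
Proof.
(* The rank is now [n.+1]; the first [n] generators form a path with odd labels, and [a n.+1] plays
   the role of [s]. *)
case: n => // n n4.
have tree : odd_tree (labelB n.+1) n.
  move=> q q1 qn; exists q.-1; rewrite /labelB.
  by split; [| |do 2?case: ifP]; lia.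
have sub (G : groupType) (a : nat -> G) :
    artin_family (labelB n.+1) n.+1 a -> artin_family (labelB n.+1) n a.
  by move=> ra p q p0 pq qn; apply: ra => //; lia.
have comm (G : groupType) (a : nat -> G) p : artin_family (labelB n.+1) n.+1 a ->
    0 < p -> p < n -> commute (a p) (a n.+1).
  move=> ra p0 pn; apply: (artin_family2 ra) => //; first by lia.
  by rewrite /labelB; case: ifP; lia.
split.
  have [a ra /spanning_pred span] := artin_group_family n.+1 (labelB_ge2 n.+1).
  have a1s := comm _ _ 1 ra isT (ltnW (ltnW n4)).
  apply: (commutator_subgroup_fg span (r := 1)) => //; first by lia.
    exact: commutator_subgroup_ratio (sub _ _ ra) tree.
  (* Vertex 2 is braided with [a 1], vertex [n] has the relation of length four with [s], and all
     others commute with both. *)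
  move=> p p0 pn; have [->|p1] := eqVneq p 1.
    by constructor 1; split=> //; exact: commute_refl.
  have [->|p2] := eqVneq p 2.
    constructor 2; split; last by apply: comm => //; lia.
    have l12 : labelB n.+1 1 2 = 3 by rewrite /labelB /=; case: ifP; lia.
    by have := ra 1 2 isT isT; rewrite l12 => -> //; lia.
  have a1p : commute (a p) (a 1).
    apply/commute_sym/(artin_family2 ra); rewrite /labelB; try case: ifP; lia.
  have [pE|pn'] := eqVneq p n.
    constructor 3; split=> //; rewrite pE.
    by have := ra n n.+1; rewrite /labelB !eqxx; apply; lia.
  by constructor 1; split=> //; apply: comm => //; lia.
apply: perfect_commutator_subgroup => S artinS metaS.
have [a ra /spanning_pred span] := presented_artin_family artinS.
apply: (metabelian_artin_abelian metaS (sub _ _ ra) tree span (k := 4)) => //.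
- move=> q q2 qn; exists 1; rewrite /labelB.
  by split; [| |do 2?case: ifP]; lia.
- by apply: comm => //; lia.
- by apply: comm => //; lia.
Qed.

Lemma typeD_fg_perfect n : 5 <= n ->
  finitely_generated (commutator_subgroup (artin_group (typeD n))) /\
  perfect (commutator_subgroup (artin_group (typeD n))).
Proof.
move=> n5; have tree : odd_tree (labelD n) n.
  move=> q q1 qn; exists (if q == n then n.-2 else q.-1); rewrite /labelD.
  by case: eqP => ?; split; [| |case: ifP| | |case: ifP]; lia.
split.
  apply: (artin_fg _ (r := 1)) => // [|p p0 p1|p p1 pn]; try lia.
  by rewrite /labelD; case: ifP; [right | left].
(* Vertex [n] is joined only to n - 2, which is at least 3, hence to neither 1 nor 2. *)
apply: (artin_perfect _ (k := n) tree) => //; try by rewrite /labelD; try case: ifP; lia.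
move=> q q2 qn.
by exists 1; rewrite /labelD; split; [| |case: ifP]; lia.
Qed.

Lemma typeE_fg_perfect n : 6 <= n <= 8 ->
  finitely_generated (commutator_subgroup (artin_group (typeE n))) /\
  perfect (commutator_subgroup (artin_group (typeE n))).
Proof.
move=> n68; have tree : odd_tree (labelE n) n.
  move=> q q1 qn; exists (if q == n then 3 else q.-1); rewrite /labelE.
  by case: eqP => ?; split; [| |case: ifP| | |case: ifP]; lia.
split.
  apply: (artin_fg _ (r := 1)) => // [|p p0 p1|p p1 pn]; try lia.
  by rewrite /labelE; case: ifP; [right | left].
(* Vertex [n] is joined only to vertex 3. *)
apply: (artin_perfect _ (k := n) tree) => //; try by rewrite /labelE; try case: ifP; lia.
move=> q q2 qn.
by exists 1; rewrite /labelE; split; [| |case: ifP]; lia.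
Qed.

Lemma typeH_fg_perfect n : 3 <= n <= 4 ->
  finitely_generated (commutator_subgroup (artin_group (typeH n))) /\
  perfect (commutator_subgroup (artin_group (typeH n))).
Proof.
move=> n34; have tree : odd_tree labelH n.
  by move=> q q1 qn; exists q.-1; rewrite /labelH; split; [| |do 2?case: ifP]; lia.
split.
  (* The end [n] is chosen because vertex 1 lies on the edge labelled 5. *)
  apply: (artin_fg _ (r := n)) => // [|p p0 pn|p]; try lia.
  rewrite /labelH; case: ifP => /eqP; last by left.
  by case: eqP; [lia | right].
(* In rank 3 no vertex is away from both 1 and 2; in rank 4 vertex 4 is. *)
have [->|n3] := eqVneq n 3.
  apply: perfect_commutator_subgroup => S artinS metaS.
  by have [a] := presented_artin_family artinS; exact: metabelian_H3_abelian.
apply: (artin_perfect _ (k := 4) tree) => //; last by lia.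
move=> q q2 qn.
by exists 1; rewrite /labelH; split; [| |do 2?case: ifP]; lia.
Qed.

Theorem theorem1p1 :
  ((forall n : nat, 4 <= n ->
     finitely_generated (commutator_subgroup (artin_group (typeA n))) /\
     perfect (commutator_subgroup (artin_group (typeA n)))) /\
   (forall n : nat, 5 <= n ->
     finitely_generated (commutator_subgroup (artin_group (typeB n))) /\
     perfect (commutator_subgroup (artin_group (typeB n)))) /\
   (forall n : nat, 5 <= n ->
     finitely_generated (commutator_subgroup (artin_group (typeD n))) /\
     perfect (commutator_subgroup (artin_group (typeD n)))) /\
   (forall n : nat, 6 <= n <= 8 ->
     finitely_generated (commutator_subgroup (artin_group (typeE n))) /\
     perfect (commutator_subgroup (artin_group (typeE n)))) /\
   (forall n : nat, 3 <= n <= 4 ->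
     finitely_generated (commutator_subgroup (artin_group (typeH n))) /\
     perfect (commutator_subgroup (artin_group (typeH n))))) /\
  ((forall n : nat, 4 <= n -> ~ locally_indicable (artin_group (typeA n))) /\
   (forall n : nat, 5 <= n -> ~ locally_indicable (artin_group (typeB n))) /\
   (forall n : nat, 5 <= n -> ~ locally_indicable (artin_group (typeD n))) /\
   (forall n : nat, 6 <= n <= 8 -> ~ locally_indicable (artin_group (typeE n))) /\
   (forall n : nat, 3 <= n <= 4 -> ~ locally_indicable (artin_group (typeH n)))).
Proof.
have A := typeA_fg_perfect; have B := typeB_fg_perfect.
have D := typeD_fg_perfect; have E := typeE_fg_perfect.
have H := typeH_fg_perfect.
split; first by [].
do !split.
- move=> n hn; have [fg perf] := A n hn.
  apply: (artin_not_locally_indicable (p := 1) (q := 2)) fg perf => //; first by lia.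
  by move=> p q; rewrite /labelA; case: ifP.
- move=> n hn; have [fg perf] := B n hn.
  apply: (artin_not_locally_indicable (p := 1) (q := 2)) fg perf => //; first by lia.
    by rewrite /labelB; do 2?case: ifP; lia.
  by move=> p q; rewrite /labelB; do 2?case: ifP.
- move=> n hn; have [fg perf] := D n hn.
  apply: (artin_not_locally_indicable (p := 1) (q := 2)) fg perf => //; first by lia.
    by rewrite /labelD; case: ifP; lia.
  by move=> p q; rewrite /labelD; case: ifP.
- move=> n hn; have [fg perf] := E n hn.
  apply: (artin_not_locally_indicable (p := 1) (q := 2)) fg perf => //; first by lia.
    by rewrite /labelE; case: ifP; lia.
  by move=> p q; rewrite /labelE; case: ifP.
- move=> n hn; have [fg perf] := H n hn.
  (* The edge joining 1 and 2 has label 5, so the edge labelled 3 is taken between 2 and 3. *)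
  apply: (artin_not_locally_indicable (p := 2) (q := 3)) fg perf => //; first by lia.
  by move=> p q; rewrite /labelH; do 2?case: ifP.
Qed.
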